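(* Let $G$ be a finite simple connected planar graph with a fixed planar embedding, and let $G^*$ be its dual. The dynamics in $\mathcal{A}_G^{(2)}$ of the two-strategy pure coordination game on $G$ under myopic best response are equivalent to the cycle shortening flow on $C(G^* )$; precisely: for every $u_0\in\mathcal{A}_G^{(2)}$, the sequences defined by $u(0)=u_0$, $u(t+1)=f(u(t))$ and $s_0=\Psi\circ\Phi u_0$, $s_{t+1}=g(s_t)$ satisfy $\Psi\circ\Phi\,u(t)=s_t$ for all $t\ge 0$, where $f$ is the myopic best response operator and $g$ is the cycle shortening flow operator.
   Context: Game. $G=(V,E)$ has adjacency matrix $W$. A strategy profile is a map $u:V\to\{1,2\}$; the payoff to player $v$ for playing $i$ against $u$ is $w_v(i|u)=\sum_{x\in V}W_{v,x}\,\delta(i,u_x)$ ($\delta$ the Kronecker delta). $\Phi$ sends $u$ to the partition of $V$ whose parts are the sets of vertices using the same strategy; $\mathcal{A}_G^{(2)}$ is the set of equivalence classes of two-strategy profiles with the same image under $\Phi$ (i.e. profiles up to swapping the two strategies). Myopic best response operator $f:\mathcal{A}_G^{(2)}\to\mathcal{A}_G^{(2)}$: all players simultaneously (synchronously) update; given the current profile $u$, each player $v$ switches to the strategy maximizing $w_v(\cdot|u)$, and in case of a tie keeps its current strategy. (This commutes with swapping the two strategies, hence is well defined on classes.) Dual. Edges $e$ of $G$ correspond bijectively to edges $e^*$ of $G^*$ (possibly a multigraph), and vertices of $G$ to faces of $G^*$. $C(G^* )$ is the cycle space of $G^*$: the set of subgraphs (identified with edge sets) in which every vertex has even degree, a $\mathbb{Z}_2$-vector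 space under symmetric difference. $\Psi$ sends a partition $P$ of $V$ into two (possibly empty) parts to the subgraph of $G^*$ spanned by the edges $e^*$ such that $e$ joins the two parts; it takes values in $C(G^* )$. Cycle shortening flow operator $g:C(G^* )\to C(G^* )$: \[ g(c)=c+\sum_{\varphi\in F(G^* )}H(c,\varphi)\,C_\varphi , \] where the sum is over $\mathbb{Z}_2$, $F(G^* )$ is the set of faces of $G^*$ (including the outer face), $C_\varphi$ is the set of edges incident to the face $\varphi$, and $H(c,\varphi)=1$ if more than half of the edges incident to $\varphi$ are in $c$, and $0$ otherwise. *)

(* Defs.v *)
From HB Require Import structures.
From mathcomp Require Import all_boot fingroup perm generic_quotient.

Set Implicit Arguments.
Unset Strict Implicit.
Unset Printing Implicit Defensive.

Local Open Scope nat_scope.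

Record simple_graph := SimpleGraph {
  vertex :> finType;
  adj : rel vertex;
  adj_sym : symmetric adj;
  adj_irr : irreflexive adj
}.

Definition connected_graph (G : simple_graph) : Prop :=
  0 < #|G| /\ forall x y : G, connect (@adj G) x y.

(* The two strategies 1, 2 are the two elements of 'I_2. *)
Definition strategy := 'I_2.
Definition profile (G : simple_graph) := {ffun G -> strategy}.

Definition adjacency_matrix (G : simple_graph) (v x : G) : nat := adj v x.

Definition payoff (G : simple_graph) (v : G) (i : strategy) (u : profile G) :=
  \sum_(x : G) adjacency_matrix v x * (i == u x).

Definition best_response (G : simple_graph) (u : profile G) : profile G :=
  [ffun v =>
     if [forall i, payoff v i u <= payoff v (u v) u] then u v
     else [arg max_(i > u v) payoff v i u]].

(* Partitions of the vertex set into two possibly empty parts. *)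
Definition is_bipartition (G : simple_graph) : pred {set {set G}} :=
  [pred P | [exists A : {set G}, P == [set A; ~: A]]].
Definition bipartition (G : simple_graph) :=
  {P : {set {set G}} | is_bipartition P}.

Definition parts (G : simple_graph) (u : profile G) : {set {set G}} :=
  [set [set v | u v == i] | i : strategy].

Lemma ord2_neq (i j k : 'I_2) : i != j -> (k == j) = (k != i).
Proof.
rewrite -!val_eqE /=; case: i => [[|[|i]] Hi] //=;
  by case: j => [[|[|j]] Hj] //=; case: k => [[|[|k]] Hk].
Qed.

Lemma parts_setC (G : simple_graph) (u : profile G) (i : 'I_2) :
  parts u = [set [set v | u v == i]; ~: [set v | u v == i]].
Proof.
have neg k : k != i -> [set v | u v == k] = ~: [set v | u v == i].
  by move=> ki; apply/setP=> v; rewrite !inE (ord2_neq (u v) ki) negbK.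
apply/setP=> A; rewrite !inE; apply/imsetP/orP.
  case=> k _ ->; have [->|/neg ->] := eqVneq k i; first by left.
  by right.
case=> /eqP ->; first by exists i.
exists (rev_ord i) => //; apply/esym/neg; rewrite -val_eqE.
by case: i {neg} => [[|[|i]] Hi].
Qed.

Lemma parts_bipartition (G : simple_graph) (u : profile G) :
  is_bipartition (parts u).
Proof. by apply/existsP; eexists; rewrite (parts_setC u ord0). Qed.

Definition Phi_profile (G : simple_graph) (u : profile G) : bipartition G :=
  exist _ (parts u) (parts_bipartition u).

Definition same_Phi (G : simple_graph) : rel (profile G) :=
  fun u u' => Phi_profile u == Phi_profile u'.

Lemma same_Phi_refl (G : simple_graph) : reflexive (@same_Phi G).
Proof. by move=> u; apply: eqxx. Qed.
Lemma same_Phi_sym (G : simple_graph) : symmetric (@same_Phi G).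
Proof. by move=> u u'; apply: eq_sym. Qed.
Lemma same_Phi_trans (G : simple_graph) : transitive (@same_Phi G).
Proof. by move=> u u' u'' /eqP E1 /eqP E2; apply/eqP; rewrite E1. Qed.

Canonical same_Phi_equiv (G : simple_graph) :=
  EquivRel (@same_Phi G) (@same_Phi_refl G) (@same_Phi_sym G) (@same_Phi_trans G).

Local Open Scope quotient_scope.

(* The set A_G^(2). *)
Definition profile_class (G : simple_graph) := {eq_quot (@same_Phi G)}.

Definition Phi (G : simple_graph) (a : profile_class G) : bipartition G :=
  Phi_profile (repr a).

Definition myopic_best_response (G : simple_graph) (a : profile_class G) : profile_class G :=
  \pi_(profile_class G) (best_response (repr a)).

Lemma Phi_pi (G : simple_graph) (u : profile G) :
  Phi (\pi_(profile_class G) u) = Phi_profile u.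
Proof.
by apply/eqP; rewrite -[_ == _]/(same_Phi _ _) -(eqmodE (same_Phi_equiv G)) reprK.
Qed.

Definition swap (G : simple_graph) (u : profile G) : profile G :=
  [ffun v => rev_ord (u v)].

Lemma same_PhiE (G : simple_graph) (u u' : profile G) :
  same_Phi u u' = (u' == u) || (u' == swap u).
Proof.
have rE (i j : 'I_2) : (rev_ord i == j) = (i != j).
  by rewrite -!val_eqE /=; case: i => [[|[|i]] Hi] //=;
    case: j => [[|[|j]] Hj].
have r0 (i j : 'I_2) : (i == ord0) = (j == ord0) -> i = j.
  rewrite -!val_eqE /= => E; apply/val_inj.
  by case: i E => [[|[|i]] Hi] //=; case: j => [[|[|j]] Hj].
rewrite /same_Phi -val_eqE /=; apply/idP/orP=> [/eqP E|].
  have: [set v | u' v == ord0] \in parts u by rewrite E imset_f.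
  rewrite (parts_setC u ord0) !inE => /orP[] /eqP/setP eqp.
    by left; apply/eqP/ffunP=> v; apply: r0; have := eqp v; rewrite !inE.
  right; apply/eqP/ffunP=> v; apply: r0; have := eqp v.
  by rewrite !inE ffunE rE.
case=> /eqP -> //; rewrite (parts_setC u ord0) (parts_setC _ ord0).
suff ->: [set v | swap u v == ord0] = ~: [set v | u v == ord0].
  by rewrite setCK setUC.
by apply/setP=> v; rewrite !inE ffunE rE.
Qed.

Lemma payoff_swap (G : simple_graph) (v : G) i (u : profile G) :
  payoff v (rev_ord i) (swap u) = payoff v i u.
Proof.
by apply: eq_bigr => x _; rewrite ffunE (inj_eq rev_ord_inj).
Qed.

Lemma best_responseE (G : simple_graph) (u : profile G) v :
  best_response u v = if payoff v (rev_ord (u v)) u <= payoff v (u v) u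
                      then u v else rev_ord (u v).
Proof.
have two (i j : 'I_2) : i = j \/ i = rev_ord j.
  have [|ij] := eqVneq i j; [by left|right; apply/val_inj].
  move: ij; rewrite -!val_eqE /=; case: i => [[|[|i]] Hi] //=;
  by case: j => [[|[|j]] Hj].
rewrite ffunE; case: ifP => [/forallP/(_ (rev_ord (u v))) -> //|/negbT].
rewrite negb_forall => /existsP[j]; have [->|->] := two j (u v).
  by rewrite leqnn.
move=> lt; rewrite (negbTE lt); case: arg_maxnP => // k _.
have [-> /(_ (rev_ord (u v)) isT)|-> //] := two k (u v).
by rewrite /= (negbTE lt).
Qed.

Lemma best_response_swap (G : simple_graph) (u : profile G) :
  best_response (swap u) = swap (best_response u).
Proof.
apply/ffunP=> v; rewrite [RHS]ffunE !best_responseE.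
have -> : swap u v = rev_ord (u v) by rewrite ffunE.
by rewrite !payoff_swap; case: ifP.
Qed.

Lemma myopic_best_response_pi (G : simple_graph) (u : profile G) :
  myopic_best_response (\pi_(profile_class G) u) = \pi_(profile_class G) (best_response u).
Proof.
apply/eqP; rewrite eq_sym (eqmodE (same_Phi_equiv G)) /=.
have : u == repr (\pi_(profile_class G) u) %[mod profile_class G] by rewrite reprK.
rewrite (eqmodE (same_Phi_equiv G)) /= same_PhiE => /orP[] /eqP ->.
  exact: same_Phi_refl.
by rewrite best_response_swap same_PhiE eqxx orbT.
Qed.

Local Close Scope quotient_scope.

(* Each edge consists of two darts (oriented edges) exchanged by [rev_dart];  *)
(* [rot] is the cyclic order of the darts around their origin.                *)
Record cmap := CMap {
  dart :> finType;
  rev_dart : {perm dart};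
  rev_dartK : involutive rev_dart;
  rev_dart_neq : forall d, rev_dart d != d;
  rot : {perm dart}
}.

(* The dart following d on the boundary of the face on one side of d: it is   *)
(* the predecessor, around the endpoint of d, of the reverse of d.            *)
Definition face_next (M : cmap) : {perm M} := (rev_dart M * (rot M)^-1)%g.

(* A connected map without darts is a single vertex in the sphere: it has one *)
(* vertex and one face, neither of them carrying a dart.                      *)
Definition orbits (M : cmap) (s : {perm M}) : {set {set M}} :=
  if #|M| == 0 then [set set0] else porbits s.

(* A vertex is given by the set of darts leaving it, a face by the set of     *)
(* darts along its boundary, an edge by its two darts.                        *)
Definition vertices (M : cmap) : {set {set M}} := orbits (rot M).
Definition faces (M : cmap) : {set {set M}} := orbits (face_next M).
Definition edge_of (M : cmap) (d : M) : {set M} := [set d; rev_dart M d].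
Definition edges (M : cmap) : {set {set M}} := [set edge_of d | d : M].

(* Euler's formula, which for connected maps characterizes genus 0. *)
Definition planar (M : cmap) : Prop :=
  #|vertices M| + #|faces M| = #|edges M| + 2.

(* The dual map: same edges, and vertices and faces are exchanged. The        *)
(* inverse makes the faces of the dual exactly the vertices of the primal.    *)
Definition dual_map (M : cmap) : cmap :=
  @CMap (dart M) (rev_dart M) (@rev_dartK M) (@rev_dart_neq M) (face_next M)^-1%g.

Lemma rev_dart_sqr (M : cmap) : (rev_dart M * rev_dart M)%g = 1%g.
Proof. by apply/permP=> d; rewrite permM perm1 rev_dartK. Qed.

Lemma next_dual (M : cmap) : face_next (dual_map M) = (rot M)^-1%g.
Proof. by rewrite {1}/face_next /= invgK /face_next mulgA rev_dart_sqr mul1g. Qed.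

Lemma orbitsV (M : cmap) (s : {perm M}) : orbits s^-1%g = orbits s.
Proof.
by rewrite /orbits /porbits; congr (if _ then _ else _);
  apply: eq_imset => d; exact: porbitV.
Qed.

Lemma faces_dual (M : cmap) : faces (dual_map M) = vertices M.
Proof. by rewrite /faces next_dual -[RHS]orbitsV. Qed.

Lemma vertices_dual (M : cmap) : vertices (dual_map M) = faces M.
Proof. exact: (@orbitsV M). Qed.

Definition arc (G : simple_graph) := {p : G * G | adj p.1 p.2}.

Definition source (G : simple_graph) (d : arc G) : G := (val d).1.
Definition target (G : simple_graph) (d : arc G) : G := (val d).2.

Lemma rev_arc_subproof (G : simple_graph) (d : arc G) :
  adj (target d, source d).1 (target d, source d).2.
Proof. by rewrite /= adj_sym; exact: valP d. Qed.

Definition rev_arc_fun (G : simple_graph) (d : arc G) : arc G :=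
  exist _ (target d, source d) (rev_arc_subproof d).

Lemma rev_arc_funK (G : simple_graph) : involutive (@rev_arc_fun G).
Proof. by move=> d; apply/val_inj; rewrite /= -surjective_pairing. Qed.

Definition rev_arc (G : simple_graph) : {perm arc G} :=
  perm (inv_inj (@rev_arc_funK G)).

Lemma rev_arcK (G : simple_graph) : involutive (rev_arc G).
Proof. by move=> d; rewrite !permE rev_arc_funK. Qed.

Lemma rev_arc_neq (G : simple_graph) (d : arc G) : rev_arc G d != d.
Proof.
rewrite permE; apply/eqP=> /(congr1 (@source G)) E; have := valP d.
by rewrite /= -/(source d) -/(target d) -E adj_irr.
Qed.

Definition map_of (G : simple_graph) (r : {perm arc G}) : cmap :=
  @CMap (arc G) (rev_arc G) (@rev_arcK G) (@rev_arc_neq G) r.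

(* An embedding of a connected graph in the plane (equivalently the sphere),  *)
(* given up to homeomorphism by its rotation system: the arcs leaving each    *)
(* vertex are permuted cyclically.                                            *)
Record planar_embedding (G : simple_graph) := PlanarEmbedding {
  rotation : {perm arc G};
  rotation_cyclic : forall d d' : arc G,
    (d' \in porbit rotation d) = (source d' == source d);
  rotation_planar : planar (map_of rotation)
}.

Definition primal (G : simple_graph) (E : planar_embedding G) : cmap :=
  map_of (rotation E).

(* G^*; edges of [primal E] and of [dual_graph E] are the same sets of darts, *)
(* so e^* = e.                                                                *)
Definition dual_graph (G : simple_graph) (E : planar_embedding G) : cmap :=
  dual_map (primal E).

Definition symdiff (T : finType) (A B : {set T}) : {set T} :=
  (A :\: B) :|: (B :\: A).

Lemma in_symdiff (T : finType) (A B : {set T}) x :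
  (x \in symdiff A B) = (x \in A) (+) (x \in B).
Proof. by rewrite !inE; case: (x \in A); case: (x \in B). Qed.

Lemma symdiffA (T : finType) : associative (@symdiff T).
Proof. by move=> A B C; apply/setP=> x; rewrite !in_symdiff addbA. Qed.
Lemma symdiffC (T : finType) : commutative (@symdiff T).
Proof. by move=> A B; apply/setP=> x; rewrite !in_symdiff addbC. Qed.
Lemma symdiff0 (T : finType) : left_id set0 (@symdiff T).
Proof. by move=> A; apply/setP=> x; rewrite !in_symdiff inE. Qed.

HB.instance Definition _ (T : finType) :=
  Monoid.isComLaw.Build {set T} set0 (@symdiff T)
    (@symdiffA T) (@symdiffC T) (@symdiff0 T).

(* Counting darts, so that a loop contributes 2. *)
Definition degree (M : cmap) (c : {set {set M}}) (x : {set M}) : nat :=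
  #|[set d in x | edge_of d \in c]|.

Definition is_cycle (M : cmap) : pred {set {set M}} :=
  [pred c : {set {set M}} |
     (c \subset edges M) && [forall x in vertices M, ~~ odd (degree c x)]].

Definition cycle_space (M : cmap) := {c : {set {set M}} | @is_cycle M c}.

(* An edge with phi on both sides is taken once; this does not occur in the   *)
(* dual of a simple graph, which has no bridges.                              *)
Definition face_edges (M : cmap) (phi : {set M}) : {set {set M}} :=
  [set edge_of d | d in phi].

Definition majority (M : cmap) (c : {set {set M}}) (phi : {set M}) : bool :=
  #|face_edges phi| < 2 * #|face_edges phi :&: c|.

Definition shortening (M : cmap) (c : {set {set M}}) : {set {set M}} :=
  symdiff c (\big[@symdiff {set M}/set0]_(phi in faces M | majority c phi) face_edges phi).

Definition joins (G : simple_graph) (P : {set {set G}}) (d : arc G) : bool :=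
  [exists A in P, exists B in P, [&& A != B, source d \in A & target d \in B]].

Definition cut (G : simple_graph) (E : planar_embedding G) (P : {set {set G}}) :
    {set {set dual_graph E}} :=
  [set edge_of (d : dual_graph E) | d : arc G & joins P d].

Section WellDefined.

Variables (G : simple_graph) (E : planar_embedding G).

Lemma edge_ofP (d d' : dual_graph E) :
  reflect (d' = d \/ d' = rev_arc G d) (edge_of d' == edge_of d).
Proof.
apply: (iffP eqP) => [/setP/(_ d')|[-> //|->]].
  by rewrite !inE eqxx => /esym/orP[] /eqP; [left|right].
by rewrite /edge_of /= rev_arcK setUC.
Qed.

Lemma tail_rev (d : arc G) : source (rev_arc G d) = target d.
Proof. by rewrite permE. Qed.
Lemma head_rev (d : arc G) : target (rev_arc G d) = source d.
Proof. by rewrite permE. Qed.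

Lemma mem_edge_image (p : pred (arc G)) (d : arc G) :
  (forall d, p (rev_arc G d) = p d) ->
  (edge_of (d : dual_graph E) \in [set edge_of (d' : dual_graph E) | d' : arc G & p d'])
    = p d.
Proof.
move=> prev; apply/imsetP/idP => [[d' pd' /eqP/edge_ofP[]->]|pd].
- by rewrite inE in pd'.
- by rewrite prev; rewrite inE in pd'.
by exists d => //; rewrite inE.
Qed.

Lemma edge_image_sub (A : {pred arc G}) :
  [set edge_of (d : dual_graph E) | d in A] \subset edges (dual_graph E).
Proof. by apply/subsetP=> _ /imsetP[d _ ->]; apply: imset_f. Qed.

Lemma tail_next (d : arc G) : source (face_next (primal E) d) = target d.
Proof.
rewrite permM /= -tail_rev; apply/eqP.
by rewrite -(rotation_cyclic E) -porbitV; exact: (mem_porbit _ 1).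
Qed.

Lemma next_vertex (x : {set arc G}) : x \in vertices (dual_graph E) ->
  forall d, (face_next (primal E) d \in x) = (d \in x).
Proof.
rewrite /dual_graph vertices_dual /faces /orbits; case: ifP => [/eqP D0 _ d|_].
  by have := card0_eq D0 d; rewrite inE.
case/imsetP=> d0 _ -> d; rewrite -!eq_porbit_mem.
suff /eqP-> : porbit (face_next (primal E)) (face_next (primal E) d)
  == porbit (face_next (primal E)) d by [].
by rewrite eq_porbit_mem; exact: (mem_porbit _ 1).
Qed.

Lemma cut_cycle (c : {set {set dual_graph E}}) (p : pred G) :
    c \subset edges (dual_graph E) ->
    (forall d : arc G, (edge_of (d : dual_graph E) \in c) =
                       p (source d) (+) p (target d)) ->
  is_cycle c.
Proof.
move=> csub cE; rewrite /is_cycle /= csub; apply/forall_inP=> x xV.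
rewrite /degree cardsE -sum1_card.
have -> : \sum_(d in [pred d : arc G | (d \in x) && (edge_of (d : dual_graph E) \in c)]) 1
  = \sum_(d : arc G | d \in x) (p (source d) (+) p (target d)).
  rewrite big_mkcondr /=; apply: eq_bigr => d _; rewrite cE; by case: addb.
have parity (F1 F2 : arc G -> bool) :
    odd (\sum_(d | d \in x) (F1 d (+) F2 d)) =
    odd (\sum_(d | d \in x) F1 d) (+) odd (\sum_(d | d \in x) F2 d).
  elim/big_rec3: _ => // d a b e _ IH; rewrite !oddD IH !oddb.
  by rewrite !addbA; congr (_ (+) _); rewrite -!addbA; congr addb; rewrite addbC.
rewrite parity; apply/negPn.
have -> : \sum_(d : arc G | d \in x) p (target d) = \sum_(d : arc G | d \in x) p (source d).
  rewrite [RHS](reindex_inj (@perm_inj _ (face_next (primal E)))) /=.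
  by apply: eq_big => d; [rewrite next_vertex | rewrite tail_next].
by rewrite addbb.
Qed.

Lemma joinsE (A : {set G}) (d : arc G) :
  joins [set A; ~: A] d = (source d \in A) (+) (target d \in A).
Proof.
apply/exists_inP/idP => [[B BP /exists_inP[C CP]]|].
  move: BP CP; rewrite !inE => /orP[]/eqP-> /orP[]/eqP-> /and3P[];
  rewrite ?eqxx // => _; rewrite ?inE.
    by move=> -> /negbTE ->.
  by move=> /negbTE -> ->.
have nA : A != ~: A.
  apply/eqP=> /setP/(_ (source d)); rewrite inE; by case: (_ \in _).
case tA: (source d \in A); case hA: (target d \in A) => // _.
  exists A; first by rewrite !inE eqxx.
  apply/exists_inP; exists (~: A); first by rewrite !inE eqxx orbT.
  by rewrite nA tA inE hA.
exists (~: A); first by rewrite !inE eqxx orbT.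
apply/exists_inP; exists A; first by rewrite !inE eqxx.
by rewrite eq_sym nA inE tA hA.
Qed.

Lemma cut_is_cycle (P : bipartition G) : is_cycle (cut E (val P)).
Proof.
case: P => P /= /existsP[A /eqP ->].
apply: (@cut_cycle _ (mem A)) => [|d]; first exact: edge_image_sub.
rewrite /cut (mem_edge_image (p := joins [set A; ~: A])) ?joinsE // => e.
by rewrite !joinsE tail_rev head_rev addbC.
Qed.

Lemma symdiff_cycle (c c' : {set {set dual_graph E}}) :
  is_cycle c -> is_cycle c' -> is_cycle (symdiff c c').
Proof.
move=> /andP[cE /forall_inP cP] /andP[c'E /forall_inP c'P]; apply/andP; split.
  by rewrite subUset !subDset; rewrite !(subset_trans _ (subsetUr _ _)).
apply/forall_inP=> x xV; move: (cP x xV) (c'P x xV).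
have degE b : degree b x = \sum_(d in x) (edge_of d \in b).
  rewrite /degree cardsE -sum1_card big_mkcondr /=.
  by apply: eq_bigr => d _; case: (_ \in b).
rewrite !degE; under [in X in _ -> _ -> X]eq_bigr do rewrite in_symdiff.
have -> : odd (\sum_(d in x) ((edge_of d \in c) (+) (edge_of d \in c'))) =
  odd (\sum_(d in x) (edge_of d \in c)) (+) odd (\sum_(d in x) (edge_of d \in c')).
  elim/big_rec3: _ => // d a b e _ IH; rewrite !oddD IH !oddb.
  by rewrite !addbA; congr (_ (+) _); rewrite -!addbA; congr addb; rewrite addbC.
by move=> /negbTE -> /negbTE ->.
Qed.

Lemma cycle0 : is_cycle (set0 : {set {set dual_graph E}}).
Proof.
apply: (@cut_cycle _ pred0) => [|d]; [exact: sub0set | by rewrite inE].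
Qed.

Lemma face_edges_cycle (phi : {set dual_graph E}) :
  phi \in faces (dual_graph E) -> is_cycle (face_edges phi).
Proof.
rewrite /dual_graph faces_dual /vertices /orbits; case: ifP => _.
  by move=> /set1P ->; rewrite /face_edges imset0 cycle0.
case/imsetP=> d0 _ ->; apply: (@cut_cycle _ (pred1 (source d0))) => [|d].
  exact: edge_image_sub.
have dE : (source d == source d0) && (target d == source d0) = false.
  apply/negP=> /andP[/eqP t /eqP h]; have := valP d.
  by rewrite -/(source d) -/(target d) t h adj_irr.
transitivity ((source d == source d0) || (target d == source d0)); last first.
  by move: dE; rewrite /=; do 2!case: eqP.
apply/imsetP/orP => [[d']|].
  rewrite (rotation_cyclic E) => td' /eqP/edge_ofP[]->; [left|right] => //.
  by rewrite head_rev.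
case=> dd0; [exists d | exists (rev_arc G d)] => //.
- by rewrite (rotation_cyclic E).
- by rewrite (rotation_cyclic E) tail_rev.
by apply/eqP/edge_ofP; right; rewrite rev_arcK.
Qed.

Lemma shorten_cycle (c : cycle_space (dual_graph E)) : is_cycle (shortening (val c)).
Proof.
apply: symdiff_cycle; first exact: valP c.
elim/big_ind: _ => [|? ?|phi /andP[phiF _]]; first exact: cycle0.
  exact: symdiff_cycle.
exact: face_edges_cycle.
Qed.

End WellDefined.

Definition Psi (G : simple_graph) (E : planar_embedding G) (P : bipartition G) :
    cycle_space (dual_graph E) :=
  exist _ (cut E (val P)) (cut_is_cycle E P).

Definition cycle_shortening (G : simple_graph) (E : planar_embedding G)
    (c : cycle_space (dual_graph E)) : cycle_space (dual_graph E) :=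
  exist _ (shortening (val c)) (shorten_cycle c).

(* Main.v *)
From mathcomp Require Import all_boot perm generic_quotient.
Require Import Defs.

Set Implicit Arguments.
Unset Strict Implicit.
Unset Printing Implicit Defensive.

(** The face of the dual at a vertex [v] of [G] is the star of [v], and the
    edges of this face lying in the cut of [u] lead to the neighbours of [v]
    playing the strategy that [v] does not play. Hence [v] strictly prefers to
    switch exactly when a majority of its face lies in the cut. Each edge lies
    on exactly two faces, those of its endpoints, so adding the majority faces
    toggles an edge exactly when one of its two endpoints switches. *)

Definition star (G : simple_graph) (v : G) : {set arc G} :=
  [set d | source d == v].

(** The inequality is strict because a tie keeps the current strategy. *)
Definition switches (G : simple_graph) (u : profile G) (v : G) : bool :=
  payoff v (u v) u < payoff v (rev_ord (u v)) u.

Lemma eq_rev_ord2 (i j : 'I_2) : (rev_ord i == j) = (i != j).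
Proof. by case: i j => [[|[|i]] Hi] [[|[|j]] Hj]. Qed.

Lemma in_big_symdiff (T I : finType) (P : pred I) (F : I -> {set T}) x :
  (x \in \big[@symdiff T/set0]_(i | P i) F i)
    = \big[addb/false]_(i | P i) (x \in F i).
Proof.
apply: (big_morph (fun A : {set T} => x \in A)) => [A B|]; last exact: in_set0.
exact: in_symdiff.
Qed.

(** Since [G] is simple, an arc leaving [v] is determined by its target, so neighbours can be
    counted as darts. *)
Lemma payoffE (G : simple_graph) (v : G) i (u : profile G) :
  payoff v i u = #|[set d in star v | u (target d) == i]|.
Proof.
have -> : payoff v i u = #|[set x | adj v x && (u x == i)]|.
  rewrite -sum1_card big_mkcond; apply: eq_bigr => x _.
  by rewrite inE eq_sym /adjacency_matrix; case: adj; case: eqP.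
rewrite -(card_in_imset (f := @target G)); last first.
  move=> [[a b] ab] [[a' b'] ab']; rewrite !inE /source /target /=.
  move=> /andP[/eqP eav _] /andP[/eqP ea'v _] ebb'.
  by apply/val_inj; rewrite /= eav ea'v ebb'.
apply: eq_card => x; rewrite inE; apply/andP/imsetP => [[vx ux]|[d]].
  by exists (exist (fun p : G * G => adj p.1 p.2) (v, x) vx);
    rewrite // !inE /source /target /= eqxx.
rewrite !inE => /andP[/eqP <- ud] ->; split=> //; exact: (valP d).
Qed.

Lemma payoff_star (G : simple_graph) (v : G) i (u : profile G) :
  payoff v i u + payoff v (rev_ord i) u = #|star v|.
Proof.
rewrite !payoffE -(cardsID [set d | u (target d) == i] (star v)); congr (_ + _).
  by apply: eq_card => d; rewrite !inE.
apply: eq_card => d.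
by rewrite !inE (eq_sym (u _) (rev_ord i)) eq_rev_ord2 (eq_sym i) andbC.
Qed.

Lemma best_response_switches (G : simple_graph) (u : profile G) v :
  best_response u v = if switches u v then rev_ord (u v) else u v.
Proof. by rewrite best_responseE /switches leqNgt; case: ltnP. Qed.

(** With only two strategies, each endpoint that switches flips whether [v] and [w] disagree. *)
Lemma best_response_neq (G : simple_graph) (u : profile G) v w :
  (best_response u v != best_response u w)
    = (u v != u w) (+) (switches u v (+) switches u w).
Proof.
rewrite !best_response_switches; case: switches; case: switches => /=.
- by rewrite (inj_eq rev_ord_inj) addbF.
- by rewrite eq_rev_ord2 negbK addbT negbK.
- by rewrite eq_sym eq_rev_ord2 eq_sym negbK addbT negbK.
- by rewrite addbF.
Qed.

Section Duality.

Variables (G : simple_graph) (E : planar_embedding G).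

Local Notation edge d := (edge_of (d : dual_graph E)).

Lemma in_cut_parts (u : profile G) (d : arc G) :
  (edge d \in cut E (parts u)) = (u (source d) != u (target d)).
Proof.
rewrite (parts_setC u (u (source d))) /cut.
rewrite (@mem_edge_image _ E (joins _)) ?joinsE => [|e].
  by rewrite !inE eqxx addTb eq_sym.
by rewrite !joinsE tail_rev head_rev addbC.
Qed.

Lemma in_face_edges_star (v : G) (d : arc G) :
  (edge d \in face_edges (star v : {set dual_graph E}))
    = (v == source d) || (v == target d).
Proof.
apply/imsetP/orP => [[d']|].
  rewrite inE => /eqP <- /eqP/edge_ofP[]->; [left|right] => //.
  by rewrite head_rev.
case=> /eqP->; [exists d | exists (rev_arc G d)]; rewrite ?inE ?tail_rev //.
by apply/eqP/edge_ofP; right; rewrite rev_arcK.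
Qed.

Lemma source_neq_target (d : arc G) : source d != target d.
Proof.
apply/eqP=> st; have := valP d.
by rewrite -/(source d) -/(target d) st adj_irr.
Qed.

(** The two darts of an edge start at its two distinct ends, so only one of them can leave [v].
    Counting edges of a face thus amounts to counting darts of a star. *)
Lemma edge_of_star_inj (v : G) :
  {in star v &, injective (fun d : arc G => edge d)}.
Proof.
move=> d d'; rewrite !inE => /eqP dv /eqP d'v /eqP/edge_ofP[//|e].
by have := source_neq_target d'; rewrite d'v -dv e tail_rev eqxx.
Qed.

Lemma majority_star (u : profile G) (v : G) :
  majority (cut E (parts u)) (star v : {set dual_graph E}) = switches u v.
Proof.
rewrite /majority.
have -> : face_edges (star v : {set dual_graph E}) :&: cut E (parts u)
    = face_edges ([set d in star v | u (target d) == rev_ord (u v)]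
                    : {set dual_graph E}).
  apply/setP=> e; apply/setIP/imsetP => [[/imsetP[d dv ->]]|[d]].
    rewrite in_cut_parts => uE; exists d => //; move: dv; rewrite !inE.
    by move=> /eqP dv; rewrite dv eqxx eq_sym eq_rev_ord2 -dv.
  rewrite !inE (eq_sym (u _)) eq_rev_ord2 => /andP[/eqP dv ud] ->.
  by rewrite in_cut_parts dv ud; split=> //; apply: imset_f; rewrite inE dv.
rewrite /face_edges !card_in_imset -?payoffE; last first.
- exact: edge_of_star_inj.
- by move=> d d' /setIdP[dv _] /setIdP[dv' _]; apply: (@edge_of_star_inj v).
(* The star has size [a + b], with [a] the current payoff and [b] the payoff after switching;
   [a + b < b + b] cancels to [a < b]. *)
by rewrite -(payoff_star v (u v) u) mul2n -addnn ltn_add2r.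
Qed.

Lemma porbit_rotation (d : arc G) : porbit (rotation E) d = star (source d).
Proof. by apply/setP=> d'; rewrite (rotation_cyclic E) inE. Qed.

(** The dart [d0] excludes the map without darts, whose single face [set0] is not the star of the
    source of any dart. *)
Lemma faces_dual_graph (d0 : arc G) :
  faces (dual_graph E) = [set star (source d) | d : arc G].
Proof.
rewrite /dual_graph faces_dual /vertices /orbits; case: ifP => [/eqP D0|_].
  by have := card0_eq D0 d0; rewrite inE.
by apply: eq_imset => d; exact: porbit_rotation.
Qed.

(** The dart [d] lies in the first star, hence in the second. Some dart is essential here: all
    isolated vertices share the empty star. *)
Lemma star_source_inj (d : arc G) (v : G) : star (source d) = star v -> source d = v.
Proof. by move/setP/(_ d); rewrite !inE eqxx => /esym/eqP. Qed.

Lemma in_shortening_cut_parts (u : profile G) (d : arc G) :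
  (edge d \in shortening (cut E (parts u)))
    = (u (source d) != u (target d))
        (+) (switches u (source d) (+) switches u (target d)).
Proof.
rewrite in_symdiff in_cut_parts in_big_symdiff; congr addb.
set c := cut E (parts u).
(* Every face other than the stars of the two endpoints misses the edge and contributes [false]. *)
have -> : \big[addb/false]_(phi in faces (dual_graph E) | majority c phi)
             (edge d \in face_edges phi)
    = \big[addb/false]_(phi in [set star (source d); star (target d)]
                        : {set {set dual_graph E}}) majority c phi.
  rewrite big_mkcond [RHS]big_mkcond; apply: eq_bigr => phi _ /=.
  rewrite (faces_dual_graph d) !inE.
  case: imsetP => [[d' _ ->]|nface] /=; last first.
    by case: orP => // -[] /eqP phiE; case: nface;
      [exists d | exists (rev_arc G d)]; rewrite ?tail_rev.
  rewrite in_face_edges_star.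
  have starE w : (star (source d') == star w) = (source d' == w).
    by apply/eqP/eqP => [/star_source_inj|->].
  by rewrite !starE; case: majority; case: orP.
(* Both terms survive because the two stars differ, [G] having no loops. *)
rewrite big_setU1 ?big_set1 /=; first by rewrite /c !majority_star.
rewrite inE; apply: contraNN (source_neq_target d) => /eqP.
by move/star_source_inj->.
Qed.

(** This is a single time step, which the theorem iterates. *)
Lemma Psi_Phi_best_response (a : profile_class G) :
  Psi E (Phi (myopic_best_response a)) = cycle_shortening (Psi E (Phi a)).
Proof.
apply/val_inj; rewrite Phi_pi /=; set u := repr a.
(* Both sides consist of edges only, so membership has to be compared just on sets of the form
   [edge_of d]. *)
have sub1 := subsetP (proj1 (andP (cut_is_cycle E (Phi_profile (best_response u))))).
have sub2 := subsetP (proj1 (andP (shorten_cycle (Psi E (Phi_profile u))))).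
apply/setP=> e; have [/imsetP[d _ ->]|nE] := boolP (e \in edges (dual_graph E)).
  by rewrite in_cut_parts in_shortening_cut_parts best_response_neq.
by rewrite (contraNF (sub1 e) nE) (contraNF (sub2 e) nE).
Qed.

End Duality.

Theorem theorem4p2 (G : simple_graph) (connG : connected_graph G)
    (E : planar_embedding G) (u0 : profile_class G)
    (u : nat -> profile_class G) (s : nat -> cycle_space (dual_graph E)) :
  u 0 = u0 ->
  (forall t : nat, u t.+1 = myopic_best_response (u t)) ->
  s 0 = Psi E (Phi u0) ->
  (forall t : nat, s t.+1 = cycle_shortening (s t)) ->
  forall t : nat, Psi E (Phi (u t)) = s t.
Proof.
move=> u0E uS s0E sS; elim=> [|t IHt]; first by rewrite u0E.
by rewrite uS sS Psi_Phi_best_response IHt.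
Qed.
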